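(* (i) For each fixed integer $r\geq 1$, there are at most finitely many pairs of integers $(n,s)$ with $n\geq 2$, $s\geq 1$ such that $H(r,n,s)^{\mathrm{ab}}=1$. (ii) For each fixed integer $s\geq 1$, there are at most finitely many pairs of integers $(n,r)$ with $n\geq 2$, $r\geq 1$ such that $H(r,n,s)^{\mathrm{ab}}=1$.
   Context: For integers $r,s\geq 1$, $n\geq 2$, the generalized Fibonacci group $H(r,n,s)$ is the group with generators $x_0,\ldots,x_{n-1}$ and defining relations $x_i x_{i+1}\cdots x_{i+r-1}=x_{i+r}x_{i+r+1}\cdots x_{i+r+s-1}$ for $0\leq i<n$, with subscripts taken mod $n$. $G^{\mathrm{ab}}$ denotes the abelianization of a group $G$. *)

(* Defs.v *)
(* Groups are possibly infinite groupType's; the quotients below are taken by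
   equivalence relations made boolean by classical logic. *)
From HB Require Import structures.
From mathcomp Require Import all_boot.
From mathcomp Require Import generic_quotient boolp classical_sets cardinality.

Set Implicit Arguments.
Unset Strict Implicit.
Unset Printing Implicit Defensive.

Local Open Scope classical_set_scope.
Local Open Scope quotient_scope.
Local Open Scope group_scope.

Definition trivial_group (G : groupType) : Prop := forall g : G, g = 1.

Section NormalSubgroup.
Variable G : groupType.
Implicit Types (N S : set G) (x y : G).

Definition is_subgroup N : Prop := group_closed [in N].

Definition is_normal N : Prop :=
  is_subgroup N /\ forall x y, N x -> N (x ^ y).

Record normal_subgroup := NormalSubgroup {
  normal_set : set G;
  normalP : is_normal normal_set
}.

Definition normal_closure S : set G := smallest is_normal S.

Definition derived_subgroup : set G :=
  smallest is_subgroup [set c | exists x y, c = [~ x, y]].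

Lemma subgroup1 N : is_subgroup N -> N 1.
Proof. by case=> /set_mem. Qed.

Lemma subgroupF N x y : is_subgroup N -> N x -> N y -> N (x / y).
Proof. by case=> _ Nd Nx Ny; apply/set_mem/Nd; apply/mem_set. Qed.

Lemma subgroupV N x : is_subgroup N -> N x -> N x^-1.
Proof.
by move=> sN Nx; rewrite -div1g; apply: subgroupF => //; apply: subgroup1.
Qed.

Lemma subgroupM N x y : is_subgroup N -> N x -> N y -> N (x * y).
Proof.
by move=> sN Nx Ny; rewrite -[y]invgK; apply: subgroupF => //; apply: subgroupV.
Qed.

Lemma bigcap_is_subgroup (C : set (set G)) :
  C `<=` is_subgroup -> is_subgroup (\bigcap_(N in C) N).
Proof.
move=> sC; split=> [|x y /set_mem Nx /set_mem Ny]; apply/mem_set => N CN.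
  by apply: subgroup1; apply: sC.
by apply: subgroupF; [apply: sC | apply: Nx | apply: Ny].
Qed.

Lemma normal_closure_normal S : is_normal (normal_closure S).
Proof.
split=> [|x y Nx N [[sN nN] SN]].
  by apply: bigcap_is_subgroup => M [[sM _] _]; exact: sM.
exact: nN (Nx N (conj (conj sN nN) SN)).
Qed.

Lemma derived_subgroup_normal : is_normal derived_subgroup.
Proof.
have sD : is_subgroup derived_subgroup.
  by apply: bigcap_is_subgroup => M [sM _]; exact: sM.
split=> // x y Dx; rewrite -[x ^ y](mulVKg x) -commgEl.
by apply: (subgroupM sD Dx) => M [_]; apply; exists x, y.
Qed.

Definition normal_closure_subgroup S :=
  NormalSubgroup (normal_closure_normal S).
Definition derived_normal_subgroup := NormalSubgroup derived_subgroup_normal.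

End NormalSubgroup.

Section QuotientGroup.
Variables (G : groupType) (N : normal_subgroup G).
Implicit Types x y z : G.

Let sN : is_subgroup (normal_set N) := (normalP N).1.

Definition coset_rel : rel G := fun x y => `[< normal_set N (x^-1 * y) >].

Lemma coset_rel_refl : reflexive coset_rel.
Proof. by move=> x; apply/asboolP; rewrite mulVg; apply: subgroup1. Qed.

Lemma coset_rel_sym : symmetric coset_rel.
Proof.
suff imp x y : coset_rel x y -> coset_rel y x.
  by move=> x y; apply/idP/idP; apply: imp.
move=> /asboolP /(subgroupV sN) Nxy; apply/asboolP.
by rewrite invgM invgK in Nxy.
Qed.

Lemma coset_rel_trans : transitive coset_rel.
Proof.
move=> y x z /asboolP Nxy /asboolP Nyz; apply/asboolP.
by have := subgroupM sN Nxy Nyz; rewrite -mulgA mulVKg.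
Qed.

Canonical coset_equiv :=
  EquivRel coset_rel coset_rel_refl coset_rel_sym coset_rel_trans.

Definition quotient_group : Type := {eq_quot coset_equiv}.

HB.instance Definition _ : EqQuotient _ coset_equiv quotient_group :=
  EqQuotient.on quotient_group.
HB.instance Definition _ := Choice.on quotient_group.

Lemma quotient_eqP x y :
  reflect (\pi_quotient_group x = \pi_quotient_group y) (coset_rel x y).
Proof. exact: eqquotP. Qed.

Definition quotient_one : quotient_group := \pi_quotient_group 1.
Definition quotient_mul (a b : quotient_group) : quotient_group :=
  \pi_quotient_group (repr a * repr b).
Definition quotient_inv (a : quotient_group) : quotient_group :=
  \pi_quotient_group (repr a)^-1.

Lemma repr_coset x : coset_rel (repr (\pi_quotient_group x)) x.
Proof. by apply/quotient_eqP; rewrite reprK. Qed.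

Lemma quotient_mulE x y :
  quotient_mul (\pi x) (\pi y) = \pi_quotient_group (x * y).
Proof.
apply/quotient_eqP/asboolP.
have /asboolP Nx := repr_coset x; have /asboolP Ny := repr_coset y.
have := subgroupM sN ((normalP N).2 _ (repr (\pi_quotient_group y)) Nx) Ny.
by rewrite /conjg invgM -!mulgA mulVKg.
Qed.

Lemma quotient_invE x : quotient_inv (\pi x) = \pi_quotient_group x^-1.
Proof.
apply/quotient_eqP/asboolP; rewrite invgK.
have /asboolP Nx := repr_coset x.
have := (normalP N).2 _ x^-1 (subgroupV sN Nx).
by rewrite /conjg invgM !invgK -!mulgA mulVKg.
Qed.

Lemma quotient_mulA : associative quotient_mul.
Proof.
move=> a b c; rewrite -[a]reprK -[b]reprK -[c]reprK.
by rewrite !quotient_mulE mulgA.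
Qed.

Lemma quotient_1mul : left_id quotient_one quotient_mul.
Proof. by move=> a; rewrite -[a]reprK quotient_mulE mul1g. Qed.

Lemma quotient_mul1 : right_id quotient_one quotient_mul.
Proof. by move=> a; rewrite -[a]reprK quotient_mulE mulg1. Qed.

Lemma quotient_Vmul : left_inverse quotient_one quotient_inv quotient_mul.
Proof. by move=> a; rewrite -[a]reprK quotient_invE quotient_mulE mulVg. Qed.

Lemma quotient_mulV : right_inverse quotient_one quotient_inv quotient_mul.
Proof. by move=> a; rewrite -[a]reprK quotient_invE quotient_mulE mulgV. Qed.

HB.instance Definition _ := isGroup.Build quotient_group quotient_mulA
  quotient_1mul quotient_mul1 quotient_Vmul quotient_mulV.

End QuotientGroup.

Definition abelianization (G : groupType) : groupType :=
  quotient_group (derived_normal_subgroup G).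

Section FreeGroup.
Variable X : choiceType.

(* The letter (x, false) stands for x and (x, true) for its inverse. *)
Definition word : choiceType := seq (X * bool).
Implicit Types u v w : word.

Definition inv_letter (l : X * bool) : X * bool := (l.1, ~~ l.2).
Definition inv_word w : word := rev (map inv_letter w).

Inductive free_eq : word -> word -> Prop :=
| free_eq_cancel u v l : free_eq (u ++ [:: l, inv_letter l & v]) (u ++ v)
| free_eq_refl u : free_eq u u
| free_eq_sym u v : free_eq u v -> free_eq v u
| free_eq_trans u v w : free_eq u v -> free_eq v w -> free_eq u w.

Lemma inv_letterK : involutive inv_letter.
Proof. by case=> x b; rewrite /inv_letter /= negbK. Qed.

Lemma free_eq_cat u u' v v' :
  free_eq u u' -> free_eq v v' -> free_eq (u ++ v) (u' ++ v').
Proof.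
move=> uu' vv'; apply: (@free_eq_trans _ (u' ++ v)).
  elim: uu' => [w z l|w|w z _ IH|w z t _ IH1 _ IH2].
  - by rewrite -!catA; apply: free_eq_cancel.
  - exact: free_eq_refl.
  - exact: free_eq_sym.
  - exact: free_eq_trans IH1 IH2.
elim: vv' => [w z l|w|w z _ IH|w z t _ IH1 _ IH2].
- by rewrite !catA; apply: free_eq_cancel.
- exact: free_eq_refl.
- exact: free_eq_sym.
- exact: free_eq_trans IH1 IH2.
Qed.

Lemma inv_word_cat u v : inv_word (u ++ v) = inv_word v ++ inv_word u.
Proof. by rewrite /inv_word map_cat rev_cat. Qed.

Lemma free_eq_inv u v : free_eq u v -> free_eq (inv_word u) (inv_word v).
Proof.
elim=> [w z l|w|w z _ IH|w z t _ IH1 _ IH2].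
- rewrite -[[:: l, _ & z]]/([:: l; inv_letter l] ++ z) !inv_word_cat -catA.
  have -> : inv_word [:: l; inv_letter l] = [:: l; inv_letter l].
    by rewrite /inv_word /= inv_letterK.
  exact: free_eq_cancel.
- exact: free_eq_refl.
- exact: free_eq_sym.
- exact: free_eq_trans IH1 IH2.
Qed.

Lemma free_eq_Vcat u : free_eq (inv_word u ++ u) [::].
Proof.
elim: u => [|l u IH]; first exact: free_eq_refl.
rewrite -[l :: u]/([:: l] ++ u) inv_word_cat -catA.
apply: free_eq_trans IH.
by have := free_eq_cancel (inv_word u) u (inv_letter l); rewrite inv_letterK.
Qed.

Lemma inv_wordK : involutive inv_word.
Proof.
move=> u; rewrite /inv_word map_rev revK -map_comp.
by rewrite (eq_map (_ : _ =1 id)) ?map_id // => l /=; rewrite inv_letterK.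
Qed.

Definition free_rel : rel word := fun u v => `[< free_eq u v >].

Lemma free_rel_refl : reflexive free_rel.
Proof. by move=> u; apply/asboolP; apply: free_eq_refl. Qed.

Lemma free_rel_sym : symmetric free_rel.
Proof.
by move=> u v; apply/asboolP/asboolP => /free_eq_sym.
Qed.

Lemma free_rel_trans : transitive free_rel.
Proof.
move=> v u w /asboolP uv /asboolP vw; apply/asboolP.
exact: free_eq_trans uv vw.
Qed.

Canonical free_equiv :=
  EquivRel free_rel free_rel_refl free_rel_sym free_rel_trans.

Definition free_group : Type := {eq_quot free_equiv}.

HB.instance Definition _ : EqQuotient _ free_equiv free_group :=
  EqQuotient.on free_group.
HB.instance Definition _ := Choice.on free_group.

Lemma free_eqP u v : \pi_free_group u = \pi_free_group v <-> free_eq u v.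
Proof. by split=> [/eqquotP/asboolP|uv]; last exact/eqquotP/asboolP. Qed.

Definition free_one : free_group := \pi_free_group [::].
Definition free_mul (a b : free_group) : free_group :=
  \pi_free_group (repr a ++ repr b).
Definition free_inv (a : free_group) : free_group :=
  \pi_free_group (inv_word (repr a)).

Lemma free_repr u : free_eq (repr (\pi_free_group u)) u.
Proof. by apply/free_eqP; rewrite reprK. Qed.

Lemma free_mulE u v : free_mul (\pi u) (\pi v) = \pi_free_group (u ++ v).
Proof. by apply/free_eqP; apply: free_eq_cat; apply: free_repr. Qed.

Lemma free_invE u : free_inv (\pi u) = \pi_free_group (inv_word u).
Proof. by apply/free_eqP; apply: free_eq_inv; apply: free_repr. Qed.

Lemma free_mulA : associative free_mul.
Proof.
move=> a b c; rewrite -[a]reprK -[b]reprK -[c]reprK.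
by rewrite !free_mulE catA.
Qed.

Lemma free_1mul : left_id free_one free_mul.
Proof. by move=> a; rewrite -[a]reprK free_mulE. Qed.

Lemma free_mul1 : right_id free_one free_mul.
Proof. by move=> a; rewrite -[a]reprK free_mulE cats0. Qed.

Lemma free_Vmul : left_inverse free_one free_inv free_mul.
Proof.
move=> a; rewrite -[a]reprK free_invE free_mulE.
by apply/free_eqP; apply: free_eq_Vcat.
Qed.

Lemma free_mulV : right_inverse free_one free_inv free_mul.
Proof.
move=> a; rewrite -[a]reprK free_invE free_mulE; apply/free_eqP.
by rewrite -{1}[repr a]inv_wordK; apply: free_eq_Vcat.
Qed.

HB.instance Definition _ := isGroup.Build free_group
  free_mulA free_1mul free_mul1 free_Vmul free_mulV.

Definition free_gen (x : X) : free_group := \pi_free_group [:: (x, false)].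

End FreeGroup.

(* The group < X | u = v for (u, v) in R >. *)
Definition presented_group (X : choiceType)
    (R : set (free_group X * free_group X)) : groupType :=
  quotient_group (normal_closure_subgroup [set p.1 / p.2 | p in R]).

Lemma ltn_shift n (i : 'I_n) k : (i + k) %% n < n.
Proof. by rewrite ltn_mod (leq_ltn_trans _ (ltn_ord i)). Qed.

(* i + k mod n, as an element of 'I_n for every n: i : 'I_n forces n > 0. *)
Definition ord_shift n (i : 'I_n) (k : nat) : 'I_n := Ordinal (ltn_shift i k).

Definition gfib_relations r n s : set (free_group 'I_n * free_group 'I_n) :=
  [set (\prod_(k < r) free_gen (ord_shift i k),
        \prod_(k < s) free_gen (ord_shift i (r + k))) | i in [set: 'I_n]].
Arguments gfib_relations : clear implicits.

Definition gfib_group (r n s : nat) : groupType :=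
  presented_group (gfib_relations r n s).

(* Main.v *)
(* Triviality of the abelianization says that f(t) = 1 + ... + t^(r-1)
   - t^r (1 + ... + t^(s-1)) is invertible modulo t^n - 1 over the integers, so
   there is an n-periodic integer sequence g which the operator f(shift) sends
   to the indicator of the multiples of n. Summing over a period gives
   |r - s| = 1, and then f has no complex root of absolute value 1. Factoring
   f into linear factors shift - z, each of which expands the l^1 norm over a
   period by at least |1 - |z||, bounds the norm of g by a constant
   independent of n. As g is integral, for n large it vanishes on deg f
   consecutive places; the recurrence f(shift) g = 0 propagates these zeros in
   both directions up to a multiple of n, where f(shift) g = 1 is
   contradicted. *)
Require Import Defs.
From mathcomp Require Import all_boot all_order all_algebra all_field.
From mathcomp Require Import boolp classical_sets functions cardinality.
From mathcomp Require Import generic_quotient zify.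

Set Implicit Arguments.
Unset Strict Implicit.
Unset Printing Implicit Defensive.

Import Order.TTheory GRing.Theory Num.Theory.

(** * Additive invariants of a presented group and of its abelianization *)

Section AbelianizedPresentation.

Local Open Scope ring_scope.
Local Open Scope classical_set_scope.
Local Open Scope quotient_scope.

Variables (X : choiceType) (V : zmodType) (v : X -> V).

(** The homomorphism from the free group to [V] extending [v], read on words. *)
Definition word_sum (w : word X) : V :=
  \sum_(l <- w) if l.2 then - v l.1 else v l.1.

Lemma word_sum_free_eq u w : free_eq u w -> word_sum u = word_sum w.
Proof.
elim=> {u w} [u w l|//|u w _ -> //|u w t _ -> _ -> //].
rewrite /word_sum !big_cat !big_cons /=; congr (_ + _).
by case: l => x [] /=; rewrite addrA ?addNr ?subrr add0r.
Qed.

Definition free_sum (a : free_group X) : V := word_sum (repr a).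

Lemma free_sumE w : free_sum (\pi w) = word_sum w.
Proof. exact/word_sum_free_eq/free_repr. Qed.

Lemma free_sum_gen x : free_sum (free_gen x) = v x.
Proof. by rewrite free_sumE /word_sum big_seq1. Qed.

Lemma free_sum1 : free_sum 1%g = 0.
Proof. by rewrite (free_sumE [::]) /word_sum big_nil. Qed.

Lemma free_sumM a b : free_sum (a * b)%g = free_sum a + free_sum b.
Proof. by rewrite -[LHS]free_sumE reprK free_sumE /word_sum big_cat. Qed.

Lemma free_sumV a : free_sum a^-1%g = - free_sum a.
Proof. by apply/eqP; rewrite -addr_eq0 -free_sumM mulVg free_sum1. Qed.

Lemma free_sum_prod n (F : nat -> free_group X) :
  free_sum (\prod_(k < n) F k)%g = \sum_(k < n) free_sum (F k).
Proof. by rewrite (big_morph _ free_sumM free_sum1). Qed.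

Variable R : set (free_group X * free_group X).
Variable I : set V.
Hypothesis I0 : I 0.
Hypothesis IB : forall a b, I a -> I b -> I (a - b).
Hypothesis IR : forall p, R p -> I (free_sum p.1 - free_sum p.2).

Let IN a : I a -> I (- a).
Proof. by move=> Ia; rewrite -sub0r; apply: IB. Qed.

Let ID a b : I a -> I b -> I (a + b).
Proof. by move=> Ia Ib; rewrite -[b]opprK; apply: IB => //; apply: IN. Qed.

(** The set [I] stands for a subgroup of [V] containing the images of the relators. Its preimage
    under [free_sum] is normal because [V] is commutative. *)
Lemma normal_closure_free_sum a :
  normal_closure [set (p.1 / p.2)%g | p in R] a -> I (free_sum a).
Proof.
move=> Ca; apply: (Ca [set a | I (free_sum a)]); split.
  split=> [|x y Ix]; last first.
    by rewrite /conjg /= !free_sumM free_sumV addrCA addNr addr0.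
  split=> [|x y /set_mem Ix /set_mem Iy]; apply/mem_set.
    by rewrite /= free_sum1.
  by rewrite /= free_sumM free_sumV; apply: IB.
by move=> _ [p Rp <-]; rewrite /= free_sumM free_sumV; apply: IR.
Qed.

Let G := presented_group R.

Let piG (a : free_group X) : G :=
  \pi_(quotient_group (normal_closure_subgroup [set (p.1 / p.2)%g | p in R])) a.

Let piG_sum a b : piG a = piG b -> I (free_sum a) -> I (free_sum b).
Proof.
move=> /quotient_eqP/asboolP/normal_closure_free_sum.
by rewrite free_sumM free_sumV => Iab Ia; have := ID Ia Iab; rewrite addrA subrr add0r.
Qed.

Let piGM a b : piG (a * b)%g = (piG a * piG b)%g.
Proof. exact/esym/quotient_mulE. Qed.

Let piGV a : piG a^-1%g = (piG a)^-1%g.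
Proof. exact/esym/quotient_invE. Qed.

Let piGK (g : G) : piG (repr g) = g.
Proof. exact: reprK. Qed.

(** The elements of [G] with a representative of sum in [I] form a subgroup, which contains the
    commutators since their sums vanish; [piG_sum] makes the representative irrelevant. *)
Lemma derived_free_sum a : derived_subgroup (piG a) -> I (free_sum a).
Proof.
pose D := [set piG b | b in [set b | I (free_sum b)]].
move=> Da; suff [b Ib /piG_sum] : D (piG a) by apply.
apply: Da; split.
  split=> [|_ _ /set_mem[x Ix <-] /set_mem[y Iy <-]]; apply/mem_set.
    by exists 1%g; rewrite //= free_sum1.
  exists (x / y)%g; last by rewrite piGM piGV.
  by rewrite /= free_sumM free_sumV; apply: IB.
move=> _ [x [y ->]]; exists [~ repr x, repr y]%g.
  rewrite /= /commg /conjg !free_sumM !free_sumV.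
  by rewrite [X in _ + X]addrCA addNr addr0 addNr.
by rewrite /commg /conjg !piGM !piGV !piGK.
Qed.

(** In effect [free_sum] factors through a map from the abelianization to [V] modulo [I]; the
    predicate [I] avoids forming that quotient. *)
Lemma trivial_abelianization_gen x : trivial_group (abelianization G) -> I (v x).
Proof.
move=> triv; rewrite -free_sum_gen; apply: derived_free_sum.
pose pi_ab := \pi_(quotient_group (derived_normal_subgroup G)).
have /quotient_eqP/asboolP : pi_ab 1%g = pi_ab (piG (free_gen x)).
  by rewrite [RHS]triv [LHS]triv.
by rewrite invg1 mul1g.
Qed.

End AbelianizedPresentation.

(** * Periodic sequences under polynomials in the shift *)

Section PeriodicSequences.

Local Open Scope ring_scope.

Lemma sum_period_shift (V : nmodType) (g : nat -> V) n k :
  (forall m, g (m + n)%N = g m) -> \sum_(m < n) g (m + k)%N = \sum_(m < n) g m.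
Proof.
move=> gn; elim: k => [|k <-]; first by under eq_bigr do rewrite addn0.
case: n gn => [|n] gn; first by rewrite !big_ord0.
rewrite big_ord_recr big_ord_recl /= addrC addnS -addSn addnC gn add0n.
by congr (_ + _); apply: eq_bigr => i _; rewrite /bump addnS.
Qed.

Lemma sum_dvdn_period (V : pzSemiRingType) n : (0 < n)%N ->
  \sum_(m < n) (n %| m)%N%:R = 1 :> V.
Proof.
case: n => // n _; rewrite big_ord_recl dvdn0 big1 ?addr0 // => i _.
by rewrite gtnNdvd //= ltnS.
Qed.

Section ShiftAction.

Variable R : comNzRingType.
Implicit Types (p q : {poly R}) (g : nat -> R).

(** Makes sequences a module over [{poly R}], with ['X] acting as the shift. *)
Definition shift_act p g (m : nat) : R := \sum_(i < size p) p`_i * g (m + i)%N.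

Lemma shift_act_widen n p g m : (size p <= n)%N ->
  shift_act p g m = \sum_(i < n) p`_i * g (m + i)%N.
Proof.
move=> le_pn; rewrite /shift_act (big_ord_widen n (fun i => p`_i * g (m + i)%N)) //.
rewrite big_mkcond; apply: eq_bigr => i _; case: ltnP => // le_pi.
by rewrite nth_default ?mul0r.
Qed.

Lemma shift_actB p q g m :
  shift_act (p - q) g m = shift_act p g m - shift_act q g m.
Proof.
pose n := maxn (size p) (size q).
have le_pq : (size (p - q)%R <= n)%N.
  by rewrite (leq_trans (size_polyD p (- q))) ?size_polyN.
rewrite !(@shift_act_widen n _ g m) ?leq_maxl ?leq_maxr //.
by rewrite -sumrB; apply: eq_bigr => i _; rewrite coefB mulrBl.
Qed.

Lemma shift_act0 g m : shift_act 0 g m = 0.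
Proof. by rewrite /shift_act size_poly0 big_ord0. Qed.

Lemma shift_actD p q g m :
  shift_act (p + q) g m = shift_act p g m + shift_act q g m.
Proof.
by rewrite -[q in LHS]opprK -[- q]sub0r !shift_actB shift_act0 sub0r opprK.
Qed.

Lemma shift_act_sum n (P : nat -> {poly R}) g m :
  shift_act (\sum_(k < n) P k) g m = \sum_(k < n) shift_act (P k) g m.
Proof.
exact: (big_morph (fun p => shift_act p g m) (fun p q => shift_actD p q g m)
  (shift_act0 g m)).
Qed.

Lemma shift_actZ a p g m : shift_act (a *: p) g m = a * shift_act p g m.
Proof.
rewrite (shift_act_widen g m (size_scale_leq a p)) mulr_sumr.
by apply: eq_bigr => i _; rewrite coefZ mulrA.
Qed.

Lemma shift_actXM p g m : shift_act ('X * p) g m = shift_act p g m.+1.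
Proof.
have le_Xp : (size ('X * p)%R <= (size p).+1)%N.
  by rewrite (leq_trans (size_polyMleq _ _)) ?size_polyX.
rewrite (shift_act_widen _ _ le_Xp) big_ord_recl coefXM mul0r add0r.
by apply: eq_bigr => i _; rewrite coefXM /= addnS.
Qed.

Lemma shift_act1 g m : shift_act 1 g m = g m.
Proof. by rewrite /shift_act size_poly1 big_ord1 coef1 mul1r addn0. Qed.

Lemma shift_actXn k g m : shift_act 'X^k g m = g (m + k)%N.
Proof.
elim: k m => [|k IH] m; first by rewrite shift_act1 addn0.
by rewrite exprS shift_actXM IH addnS.
Qed.

Lemma shift_act_period p g n :
  (forall m, g (m + n)%N = g m) -> forall m, shift_act p g (m + n) = shift_act p g m.
Proof. by move=> gn m; apply: eq_bigr => i _; rewrite addnAC gn. Qed.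

End ShiftAction.

(* The shift is an isometry for the l^1 norm over a period. *)
Lemma shift_act_XsubC_norm (R : numDomainType) (z : R) (h : nat -> R) n :
  (forall m, h (m + n)%N = h m) ->
  `|1 - `|z| | * (\sum_(m < n) `|h m|) <= \sum_(m < n) `|h m.+1 - z * h m|.
Proof.
move=> hn; set N := \sum_(m < n) _.
have N_ge0 : 0 <= N by apply: sumr_ge0.
have SN : \sum_(m < n) `|h m.+1| = N.
  rewrite -[RHS](@sum_period_shift _ (fun m => `|h m|) n 1) => [|m]; last by rewrite hn.
  by apply: eq_bigr => m _; rewrite addn1.
(* The absolute value splits into two inequalities, each a termwise reverse triangle inequality once
   one copy of [N] is replaced by the shifted sum. *)
rewrite -{1}(ger0_norm N_ge0) -normrM mulrBl mul1r.
apply/real_ler_normlP; first by rewrite rpredB ?rpredM ?ger0_real.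
rewrite opprB mulr_sumr; split; rewrite -?[X in X - _]SN -?[X in _ - X]SN -sumrB;
  apply: ler_sum => m _; rewrite -normrM ?lerB_dist //.
by rewrite distrC lerB_dist.
Qed.

(** Linear factors are peeled off one at a time: the sequence produced by the remaining ones is
    still periodic. *)
Lemma shift_act_norm (R : numDomainType) (rs : seq R) (g : nat -> R) n :
  (forall m, g (m + n)%N = g m) ->
  (\prod_(z <- rs) `|1 - `|z| |) * (\sum_(m < n) `|g m|) <=
    \sum_(m < n) `|shift_act (\prod_(z <- rs) ('X - z%:P)) g m|.
Proof.
move=> gn; elim: rs => [|z rs IH].
  by rewrite !big_nil mul1r; under [leRHS]eq_bigr do rewrite shift_act1.
rewrite !big_cons -mulrA (le_trans (ler_wpM2l _ IH)) //.
apply: le_trans (shift_act_XsubC_norm z (shift_act_period _ gn)) _.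
apply: ler_sum => m _.
by rewrite mulrBl shift_actB shift_actXM mul_polyC shift_actZ.
Qed.

(** [K] depends on [p] alone: it exceeds the inverse of the expansion constant [c], which is
    positive because no root lies on the unit circle. *)
Lemma shift_act_bounded (p : {poly algC}) : p != 0 ->
  (forall z, root p z -> `|z| != 1) ->
  exists K : nat, forall n (g : nat -> algC), (forall m, g (m + n)%N = g m) ->
    \sum_(m < n) `|shift_act p g m| <= 1 -> \sum_(m < n) `|g m| < K%:R.
Proof.
move=> p0 nroot; have [rs Dp] := closed_field_poly_normal p.
pose c := `|lead_coef p| * \prod_(z <- rs) `|1 - `|z| |.
have c_gt0 : 0 < c.
  rewrite mulr_gt0 ?normr_gt0 ?lead_coef_eq0 // big_seq prodr_gt0 // => z rs_z.
  rewrite normr_gt0 subr_eq0 eq_sym nroot //.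
  by rewrite Dp rootZ ?lead_coef_eq0 // root_prod_XsubC.
exists (Num.bound c^-1) => n g gn pg.
apply: le_lt_trans (archi_boundP _); last by rewrite invr_ge0 ltW.
rewrite -[c^-1]mul1r ler_pdivlMr // mulrC; apply: le_trans pg.
rewrite /c -mulrA [X in _ <= X](_ : _ = `|lead_coef p| *
    \sum_(m < n) `|shift_act (\prod_(z <- rs) ('X - z%:P)) g m|).
  by rewrite ler_wpM2l ?shift_act_norm.
by rewrite mulr_sumr; apply: eq_bigr => m _; rewrite {1}Dp shift_actZ normrM.
Qed.


(** * The recurrence attached to the relations, and its polynomial *)

Section FibonacciRecurrence.

Variables r s : nat.
Hypotheses (r_gt0 : (0 < r)%N) (s_gt0 : (0 < s)%N).

(** Kept over any [zmodType], to serve both integer sequences and their images in [algC]. *)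
Definition gfib_op (V : zmodType) (g : nat -> V) m : V :=
  \sum_(k < r) g (m + k)%N - \sum_(k < s) g (m + (r + k))%N.

Definition gfib_poly : {poly algC} := \sum_(k < r) 'X^k - \sum_(k < s) 'X^(r + k).

Lemma shift_act_gfib_poly g m : shift_act gfib_poly g m = gfib_op g m.
Proof.
rewrite shift_actB shift_act_sum (shift_act_sum s (fun k => 'X^(r + k))).
by congr (_ - _); apply: eq_bigr => k _; rewrite shift_actXn.
Qed.

Lemma gfib_poly_horner z :
  gfib_poly.[z] = \sum_(k < r) z ^+ k - z ^+ r * \sum_(k < s) z ^+ k.
Proof.
rewrite !hornerE !horner_sum mulr_sumr.
by congr (_ - _); apply: eq_bigr => k _; rewrite hornerXn ?exprD.
Qed.

Lemma gfib_poly_horner1 : gfib_poly.[1] = r%:R - s%:R.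
Proof.
rewrite gfib_poly_horner expr1n mul1r.
by under eq_bigr do rewrite expr1n; under [X in _ - X]eq_bigr do rewrite expr1n;
  rewrite !sumr_const !card_ord.
Qed.

Lemma gfib_poly_neq0 : r != s -> gfib_poly != 0.
Proof.
apply: contra_neq => p0; apply/eqP; rewrite -(eqr_nat algC) -subr_eq0.
by rewrite -gfib_poly_horner1 p0 horner0.
Qed.

(* (1 - z) f(z) = 1 - 2 z^r + z^(r+s), and for |z| = 1 the triangle inequality
   |1 + z^(r+s)| <= 2 = |2 z^r| is an equality only when z^(r+s) = 1. *)
Lemma gfib_poly_root_norm z :
  s = r.+1 \/ r = s.+1 -> root gfib_poly z -> `|z| != 1.
Proof.
move=> rs /rootP pz; apply/eqP => z1.
have neq_rs : r != s by case: rs => ->; rewrite neq_ltn ltnSn ?orbT.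
have Ez : 1 + z ^+ (r + s) = z ^+ r *+ 2.
  have := congr1 ( *%R (z - 1)) pz; rewrite mulr0 gfib_poly_horner mulrBr mulrCA.
  rewrite -!subrX1 mulrBr mulr1 -exprD => /eqP.
  by rewrite subr_eq0 subr_eq addrAC eq_sym subr_eq => /eqP; rewrite addrC mulr2n.
have [|t _ [/esym]] := @normCDeq _ 1 (z ^+ (r + s)).
  by rewrite Ez normrMn !normrX z1 normr1 !expr1n.
rewrite normr1 mul1r => ->; rewrite normrX z1 expr1n mulr1 => zrs.
have zr : z ^+ r = 1.
  by apply: (@mulIf _ 2); rewrite ?pnatr_eq0 ?mul1r ?mulr_natr -?Ez ?zrs.
have zs : z ^+ s = 1 by rewrite -zrs exprD zr mul1r.
(* The exponents [r] and [s] are consecutive, so [z] is a quotient of two powers equal to 1. At 1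
   the polynomial takes the nonzero value r - s. *)
have zE : z = 1.
  by case: rs => E; [move: zs; rewrite E exprS zr | move: zr; rewrite E exprS zs];
    rewrite mulr1.
move: pz; rewrite zE gfib_poly_horner1 => /eqP.
by rewrite subr_eq0 eqr_nat (negPf neq_rs).
Qed.

Variable V : zmodType.
Implicit Type g : nat -> V.

Lemma gfib_opB g h m : gfib_op (g - h) m = gfib_op g m - gfib_op h m.
Proof. by rewrite /gfib_op !sumrB !opprD !opprK addrACA. Qed.

(** For [s] positive, [r + s.-1] is the degree of [gfib_poly], hence the order of the recurrence. *)
Definition zero_window g m := forall i, (i < r + s.-1)%N -> g (m + i)%N = 0.

(** The extreme coefficients of [gfib_poly] are 1 and -1, so zeros propagate both ways over any [V],
    without division. *)
Lemma gfib_op_window_last g m : zero_window g m -> gfib_op g m = - g (m + (r + s.-1))%N.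
Proof.
move=> gm; rewrite /gfib_op big1 ?sub0r; last first.
  by move=> i _; rewrite gm // ltn_addr.
move: gm; rewrite /zero_window; case: s s_gt0 => // s' _ gm.
rewrite big_ord_recr /= big1 ?add0r // => i _.
by rewrite gm // ltn_add2l.
Qed.

Lemma gfib_op_window_first g m : zero_window g m.+1 -> gfib_op g m = g m.
Proof.
rewrite /zero_window /gfib_op; case: r r_gt0 => // r' _ gm.
rewrite [X in _ - X]big1 ?subr0; last first.
  by move=> i _; rewrite addSn addnS -addSn gm // addSnnS prednK // ltn_add2l.
rewrite big_ord_recl addn0 big1 ?addr0 // => i _.
by rewrite /bump addnS -addSn gm // addSn ltnS ltnW // ltn_addr.
Qed.

Lemma zero_windowS g m : zero_window g m -> gfib_op g m = 0 -> zero_window g m.+1.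
Proof.
move=> gm /eqP; rewrite gfib_op_window_last // oppr_eq0 => /eqP glast i.
rewrite addSnnS; case: (ltnP i.+1 (r + s.-1)) => [/gm //|le_i lt_i].
by rewrite (_ : i.+1 = r + s.-1)%N //; apply/eqP; rewrite eqn_leq lt_i.
Qed.

Lemma zero_window_pred g m : zero_window g m.+1 -> gfib_op g m = 0 -> zero_window g m.
Proof.
move=> gm g0 [|i] lt_i; first by rewrite addn0 -gfib_op_window_first.
by rewrite -addSnnS gm // ltnW.
Qed.

(* The window propagates forwards from a to the multiple m0 of n in [a, a + n)
   and, by periodicity, backwards from a + n to m0 + 1; but then the operator
   vanishes at m0. *)
Lemma gfib_op_zero_window g n a : (0 < n)%N ->
  (forall m, g (m + n)%N = g m) ->
  (forall m, ~~ (n %| m)%N -> gfib_op g m = 0) ->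
  zero_window g a -> exists2 m, (n %| m)%N & gfib_op g m = 0.
Proof.
move=> n_gt0 gn g0 ga; pose m0 := ((a + n.-1) %/ n * n)%N.
have n_m0 : (n %| m0)%N by exact: dvdn_mull.
have le_m0 : (m0 <= a + n.-1)%N by exact: leq_trunc_div.
have gt_m0 : (a + n.-1 < m0 + n)%N.
  by have := ltn_ceil (a + n.-1) n_gt0; rewrite mulSnr.
move: (m0) n_m0 le_m0 gt_m0 => {}m0 n_m0 le_m0 gt_m0.
have lt_m0 : (a <= m0)%N by lia.
(* Distinct multiples of [n] are at least [n] apart, so neither propagation uses the recurrence at a
   multiple of [n]. *)
have gap p q : (n %| p)%N -> (n %| q)%N -> (p < q)%N -> (p + n <= q)%N.
  move=> n_p n_q lt_pq; have := dvdn_leq _ (dvdn_sub n_q n_p); rewrite subn_gt0.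
  by move/(_ lt_pq); lia.
have fwd k : (a + k <= m0)%N -> zero_window g (a + k).
  elim: k => [|k IH] le_k; first by rewrite addn0.
  rewrite addnS; apply: zero_windowS; first by apply: IH; lia.
  by apply: g0; apply/negP => /gap/(_ n_m0); lia.
have bwd k : (m0 + k < a + n)%N -> zero_window g (a + n - k).
  elim: k => [|k IH] lt_k; first by move=> i lt_i; rewrite subn0 addnAC gn ga.
  have Ek : (a + n - k.+1).+1 = (a + n - k)%N by lia.
  apply: zero_window_pred; first by rewrite Ek; apply: IH; lia.
  by apply: g0; apply/negP => /(gap _ _ n_m0); lia.
(* The window at [m0.+1] reduces the operator at [m0] to [g m0], which the window at [m0] makes
   zero. *)
exists m0 => //; rewrite gfib_op_window_first.
  by rewrite -[m0]addn0 -(subnKC lt_m0) fwd ?subnKC //; lia.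
by rewrite (_ : m0.+1 = a + n - (a + n - m0.+1))%N; [apply: bwd|]; lia.
Qed.

End FibonacciRecurrence.

(** Pigeonhole: each of the [K] disjoint blocks of length [d] that is not identically zero adds at
    least 1 to the sum. *)
Lemma zero_block (w : nat -> nat) K d :
  (\sum_(m < K * d) w m < K)%N ->
  exists a, forall i, (i < d)%N -> w (a + i)%N = 0%N.
Proof.
elim: K => [|K IH]; rewrite ?ltn0 // mulSnr big_split_ord /= => lt_K.
case: (posnP (\sum_(i < d) w (K * d + i)%N)) => [/eqP|w_gt0].
  rewrite sum_nat_eq0 => /forallP w0; exists (K * d)%N => i lt_i.
  exact/eqP/(w0 (Ordinal lt_i)).
by apply: IH; rewrite -ltnS; apply: leq_trans lt_K; rewrite ltnS -addn1 leq_add2l.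
Qed.

Lemma gfib_op_periodic r s : (0 < r)%N -> (0 < s)%N -> s = r.+1 \/ r = s.+1 ->
  exists N, forall n (g : nat -> int), (0 < n)%N ->
    (forall m, g (m + n)%N = g m) ->
    (forall m, gfib_op r s g m = (n %| m)%N%:R) -> (n < N)%N.
Proof.
move=> r_gt0 s_gt0 rs.
have neq_rs : r != s by case: rs => ->; rewrite neq_ltn ltnSn ?orbT.
have [K ltK] := shift_act_bounded (gfib_poly_neq0 neq_rs)
  (fun z => @gfib_poly_root_norm r s z rs).
(* A period of this length holds [K] disjoint windows, while the absolute values of [g] sum to less
   than [K]. *)
exists (K * (r + s.-1))%N => n g n_gt0 gn gE; rewrite ltnNge; apply/negP => le_n.
have opC m : gfib_op r s (fun m => (g m)%:~R : algC) m = (gfib_op r s g m)%:~R.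
  by rewrite rmorphB !rmorph_sum.
have sumK : (\sum_(m < n) `|g m| < K)%N.
  rewrite -(ltr_nat algC) natr_sum; under eq_bigr do rewrite natr_absz intr_norm.
  apply: (ltK n (fun m => (g m)%:~R)) => [m|]; first by rewrite gn.
  under eq_bigr do rewrite shift_act_gfib_poly opC gE rmorph_nat normr_nat.
  by rewrite sum_dvdn_period.
have [a wa] : exists a, forall i, (i < r + s.-1)%N -> `|g (a + i)%N|%N = 0%N.
  apply: (@zero_block (fun m => `|g m|%N) K); apply: leq_ltn_trans sumK.
  rewrite (big_ord_widen n (fun m => `|g m|%N)) //.
  by rewrite [leqRHS](bigID (fun m : 'I_n => (m < K * (r + s.-1))%N)) leq_addr.
have ga : zero_window r s g a by move=> i /wa/eqP; rewrite absz_eq0 => /eqP.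
have [|m n_m] := gfib_op_zero_window r_gt0 s_gt0 n_gt0 gn _ ga.
  by move=> m /negPf n_m; rewrite gE n_m.
by rewrite gE n_m.
Qed.

Lemma gfib_op_periodic_diff r s n (g : nat -> int) : (0 < n)%N ->
  (forall m, g (m + n)%N = g m) ->
  (forall m, gfib_op r s g m = (n %| m)%N%:R) -> s = r.+1 \/ r = s.+1.
Proof.
move=> n_gt0 gn gE; have := sum_dvdn_period int n_gt0.
under eq_bigr do rewrite -gE; rewrite sumrB exchange_big [X in _ - X]exchange_big /=.
under eq_bigr do rewrite sum_period_shift //.
under [X in _ - X]eq_bigr do rewrite sum_period_shift //.
rewrite !sumr_const !card_ord -[_ *+ r]mulr_natl -[_ *+ s]mulr_natl -mulrBl => /(congr1 absz)/eqP.
(* The product of r - s and the sum of [g] over a period is 1, so both integers are units. *)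
by rewrite abszM muln_eq1 => /andP[/eqP rs _]; lia.
Qed.

End PeriodicSequences.

(** * From trivial abelianization to periodic integer sequences *)

Section TrivialAbelianization.

Local Open Scope ring_scope.
Local Open Scope classical_set_scope.

(** Generator [i] is sent to the indicator of the residue class of -i mod [n], and [I] is the image
    of the operator on periodic sequences. The conclusion is that the image of generator 0 lies in
    [I]. *)
Lemma trivial_gfib_periodic r n s : (0 < n)%N ->
  trivial_group (abelianization (gfib_group r n s)) ->
  exists2 g : nat -> int, (forall m, g (m + n)%N = g m) &
    forall m, gfib_op r s g m = (n %| m)%N%:R.
Proof.
move=> n_gt0; pose v (i : 'I_n) : nat -> int := fun m => (n %| m + i)%N%:R.
pose I : set (nat -> int) := [set f | exists2 g : nat -> int,
  (forall m, g (m + n)%N = g m) & forall m, gfib_op r s g m = f m].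
have v_shift i k m : v (ord_shift i k) m = v i (m + k)%N.
  by rewrite /v /= /dvdn modnDmr addnAC addnA.
have sum_v i N (F : nat -> nat) m :
    free_sum v (\prod_(k < N) free_gen (ord_shift i (F k)))%g m =
      \sum_(k < N) v i (m + F k)%N.
  rewrite (free_sum_prod v N (fun k => free_gen (ord_shift i (F k)))) fct_sumE.
  by apply: eq_bigr => k _; rewrite free_sum_gen v_shift.
move/(@trivial_abelianization_gen _ _ v _ I) => /(_ _ _ _ (Ordinal n_gt0))[].
- by exists 0 => // m; rewrite /gfib_op !big1 ?subrr.
- move=> f h [g gn gE] [g' g'n g'E]; exists (g - g') => m.
    by rewrite !opprfctE !addrfctE gn g'n.
  by rewrite gfib_opB gE g'E.
(* The relator of index [i] is sent to the operator applied to [v i]. *)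
- move=> _ [i _ <-]; exists (v i) => m /=.
    by rewrite /v /dvdn addnAC modnDr.
  have subE (f h : nat -> int) : (f - h) m = f m - h m by [].
  by rewrite subE (sum_v i r id) (sum_v i s (addn r)).
move=> g gn gE; exists g => // m; by rewrite gE /v addn0.
Qed.

Lemma trivial_gfib_diff r n s : (0 < n)%N ->
  trivial_group (abelianization (gfib_group r n s)) -> s = r.+1 \/ r = s.+1.
Proof.
move=> n_gt0 /(trivial_gfib_periodic n_gt0)[g].
exact: gfib_op_periodic_diff.
Qed.

Lemma trivial_gfib_bounded r s : (0 < r)%N -> (0 < s)%N ->
  exists N, forall n, (0 < n)%N ->
    trivial_group (abelianization (gfib_group r n s)) -> (n < N)%N.
Proof.
move=> r_gt0 s_gt0; case: (pselect (s = r.+1 \/ r = s.+1)) => [rs|nrs].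
  have [N ltN] := gfib_op_periodic r_gt0 s_gt0 rs.
  by exists N => n n_gt0 /(trivial_gfib_periodic n_gt0)[g]; apply: ltN.
(* No [n] qualifies here, so any bound will do. *)
by exists 0%N => n n_gt0 /(trivial_gfib_diff n_gt0).
Qed.

End TrivialAbelianization.

(** * Finiteness of the sets of pairs *)

Local Open Scope classical_set_scope.

(** Only the two neighbours of the fixed parameter [k] can occur as [l], each with a bound on [n].
    For [k] zero the value [k.-1] is harmless, since the second alternative is then impossible. *)
Lemma finite_set_bounded_adjacent (k : nat) (P : nat -> nat -> Prop) :
  (forall n l, P n l -> l = k.+1 \/ k = l.+1) ->
  (forall l, exists N, forall n, P n l -> n < N) ->
  finite_set [set p | P p.1 p.2].
Proof.
move=> Pl PN; have [N1 lt1] := PN k.+1; have [N2 lt2] := PN k.-1.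
apply: sub_finite_set (finite_setX (finite_II (maxn N1 N2)) (finite_II k.+2)).
move=> [n l] /= Pnl; split=> /=; last by have := Pl _ _ Pnl; lia.
rewrite leq_max; case: (Pl _ _ Pnl) => E.
  by rewrite lt1 // -E.
by rewrite [n < N2]lt2 ?orbT // E.
Qed.

Theorem corollary2 :
  (forall r : nat, 1 <= r ->
     finite_set [set p : nat * nat | [/\ 2 <= p.1, 1 <= p.2 &
       trivial_group (abelianization (gfib_group r p.1 p.2))]])
  /\
  (forall s : nat, 1 <= s ->
     finite_set [set p : nat * nat | [/\ 2 <= p.1, 1 <= p.2 &
       trivial_group (abelianization (gfib_group p.2 p.1 s))]]).
Proof.
split=> [r r_gt0|s s_gt0].
  apply: (@finite_set_bounded_adjacent r (fun n s => [/\ 2 <= n, 1 <= s &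
    trivial_group (abelianization (gfib_group r n s))])).
    by move=> n s [/ltnW n_gt0 _]; apply: trivial_gfib_diff.
  move=> [|s]; first by exists 0 => n [].
  have [N ltN] := trivial_gfib_bounded r_gt0 (ltn0Sn s).
  by exists N => n [/ltnW n_gt0 _]; apply: ltN.
apply: (@finite_set_bounded_adjacent s (fun n r => [/\ 2 <= n, 1 <= r &
  trivial_group (abelianization (gfib_group r n s))])).
  by move=> n r [/ltnW n_gt0 _ /(trivial_gfib_diff n_gt0)[]]; [right|left].
move=> [|r]; first by exists 0 => n [].
have [N ltN] := trivial_gfib_bounded (ltn0Sn r) s_gt0.
by exists N => n [/ltnW n_gt0 _]; apply: ltN.
Qed.
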